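(* Let $PR=\mathcal K(\mathbf L)$ be the Patras–Reutenauer Hopf algebra. For $\alpha\in\mathbf l[n]$, $$S(\alpha)=\sum_{\gamma\in\mathbf l[n]}(-1)^m\,d_{\alpha,\gamma}\,\gamma,$$ where $m=\ell(\epsilon\vee\gamma)$ and $d_{\alpha,\gamma}$ is the number of $\beta\in\mathbf l[n]$ such that, for $\Lambda=(\Lambda_1,\dots,\Lambda_m)=\beta\vee(\beta\circ\gamma)$: (i) $\beta$ is increasing with respect to $\epsilon$ within each part of $\Lambda$; (ii) $\beta\circ\gamma$ is increasing with respect to $\alpha$ within each part of $\Lambda$; (iii) for all $1\le i<m$, $\max_\epsilon(\Lambda_i)>_\epsilon\min_\epsilon(\Lambda_{i+1})$ or $\max_\alpha(\Lambda_i)>_\alpha\min_\alpha(\Lambda_{i+1})$.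
   Context: $\mathbf l[n]$ is the set of linear orders (words) $\beta=\beta_1\cdots\beta_n$ on $[n]=\{1,\dots,n\}$; $\epsilon=12\cdots n$. $PR=\bigoplus_{n\ge0}\Bbbk\,\mathbf l[n]$ is the graded Hopf algebra (over a field of characteristic $0$) with product $\alpha\cdot\alpha'=$ concatenation of $\alpha\in\mathbf l[n]$ with $\alpha'\in\mathbf l[n']$ shifted by $n$, and coproduct $\Delta(\alpha)=\sum_{S\subseteq[n]}\mathrm{st}(\alpha|_S)\otimes\mathrm{st}(\alpha|_{[n]\setminus S})$, where $\alpha|_S$ is the subword on $S$ and $\mathrm{st}$ relabels order-preservingly onto $\{1,\dots,|S|\}$; $S$ is its antipode. A word $\beta$ is also the permutation $i\mapsto\beta_i$, so $\beta\circ\gamma=\beta(\gamma_1)\cdots\beta(\gamma_n)$; a word $\beta$ is also identified with the set composition $(\{\beta_1\},\dots,\{\beta_n\})$ of $[n]$. A set composition $A=(A_1,\dots,A_k)$ is a sequence of nonempty disjoint sets with union $[n]$, $\ell(A)=k$; $A\le B$ if each part of $B$ is a union of consecutive parts of $A$. For words $\beta,\delta$, $\beta\vee\delta$ is the finest set composition $A$ with $\beta\le A$ and $\delta\le A$. ''$\beta$ increasing with respect to $\epsilon$ within a part $P$'' means the entries of $P$ appear in $\beta$ in increasing numerical order; ''$\beta\circ\gamma$ increasing with respect to $\alpha$ within $P$'' means the entries of $P$ appear in $\beta\circ\gamma$ in the same relative order as in $\alpha$. $<_\epsilon$ is the usual order and $<_\alpha$ is the order in which elements appear in the word $\alpha$;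 $\max_\epsilon,\min_\epsilon,\max_\alpha,\min_\alpha$ are the extremes with respect to these orders. *)

(* Defs.v *)
From HB Require Import structures.
From mathcomp Require Import all_boot all_order all_algebra all_fingroup.
From mathcomp Require Import finmap.
From mathcomp.multinomials Require Import monalg.

Set Implicit Arguments.
Unset Strict Implicit.
Unset Printing Implicit Defensive.

Import GRing.Theory.

(* The set [n] is 'I_n = {0, ..., n-1}.  A word b = b_1 ... b_n of l[n] is the
   permutation b : 'S_n sending a position to the letter found there; b^-1 sends
   a letter to its position. *)

Section Words.

Definition eps n : 'S_n := 1%g.

(* Products in 'S_n are composed left to right: (s * t) i = t (s i). *)
Definition wcomp n (b c : 'S_n) : 'S_n := (c * b)%g.

Lemma wcompE n (b c : 'S_n) i : wcomp b c i = b (c i).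
Proof. exact: permM. Qed.

Definition letters n (a : 'S_n) : seq 'I_n := [seq a i | i <- enum 'I_n].

Lemma mem_letters n (a : 'S_n) x : x \in letters a.
Proof. by apply/mapP; exists (a^-1 x)%g; rewrite ?mem_enum ?permKV. Qed.

Lemma letters_uniq n (a : 'S_n) : uniq (letters a).
Proof. by rewrite map_inj_uniq ?enum_uniq //; apply: perm_inj. Qed.

Lemma size_letters n (a : 'S_n) : size (letters a) = n.
Proof. by rewrite size_map size_enum_ord. Qed.

Definition cat_fun m n (a : 'S_m) (b : 'S_n) (i : 'I_(m + n)) : 'I_(m + n) :=
  match split i with
  | inl j => lshift n (a j)
  | inr k => rshift m (b k)
  end.

Lemma cat_fun_inj m n (a : 'S_m) (b : 'S_n) : injective (cat_fun a b).
Proof.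
move=> i j; rewrite /cat_fun.
case: (split_ordP i) => i' ->; case: (split_ordP j) => j' -> /eqP;
  by rewrite eq_shift // => /eqP/perm_inj ->.
Qed.

Definition wcat m n (a : 'S_m) (b : 'S_n) : 'S_(m + n) :=
  perm (@cat_fun_inj m n a b).

Definition subword n (a : 'S_n) (P : {set 'I_n}) : seq 'I_n :=
  [seq x <- letters a | x \in P].

Lemma size_subword n (a : 'S_n) (P : {set 'I_n}) : size (subword a P) == #|P|.
Proof.
rewrite cardE; apply/eqP/perm_size/uniq_perm.
- by rewrite filter_uniq ?letters_uniq.
- exact: enum_uniq.
by move=> x; rewrite mem_filter mem_letters mem_enum andbT.
Qed.

Definition subword_tuple n (a : 'S_n) (P : {set 'I_n}) : #|P|.-tuple 'I_n :=
  Tuple (size_subword a P).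

Lemma mem_subword_tuple n (a : 'S_n) (P : {set 'I_n}) i :
  tnth (subword_tuple a P) i \in P.
Proof. by have := mem_tnth i (subword_tuple a P); rewrite mem_filter => /andP[]. Qed.

(* enum P lists P increasingly, so enum_rank_in is the order-preserving
   relabelling of P onto {0, ..., #|P| - 1}. *)
Definition st_fun n (a : 'S_n) (P : {set 'I_n}) (i : 'I_#|P|) : 'I_#|P| :=
  enum_rank_in (mem_subword_tuple a i) (tnth (subword_tuple a P) i).

Lemma st_fun_inj n (a : 'S_n) (P : {set 'I_n}) : injective (st_fun a (P := P)).
Proof.
move=> i j /(congr1 enum_val); rewrite !enum_rankK_in ?mem_subword_tuple //.
by apply/tuple_uniqP/filter_uniq/letters_uniq.
Qed.

(* st (a|_P) *)
Definition st n (a : 'S_n) (P : {set 'I_n}) : 'S_#|P| :=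
  perm (@st_fun_inj n a P).

End Words.

Section SetCompositions.
Variable n : nat.

Definition is_setcomp (A : seq {set 'I_n}) :=
  uniq A && partition [set P in A] [set: 'I_n].

(* The bound on the number of parts is no restriction (the parts are nonempty
   and disjoint); it makes setcomp a finType. *)
Record setcomp := SetComp {
  parts :> n.-bseq {set 'I_n};
  _ : is_setcomp parts
}.

HB.instance Definition _ := [isSub for parts].
HB.instance Definition _ := [Finite of setcomp by <:].

(* A <= B: B is obtained by cutting the sequence A into consecutive runs, of
   lengths sh, and taking the union of each run, in the same order. *)
Definition refines (A B : setcomp) :=
  [exists sh : (size B).-tuple 'I_n.+1,
     (sumn (map val sh) == size A) &&
     (parts B == [seq \bigcup_(P <- run) P | run <- reshape (map val sh) A]
        :> seq {set 'I_n})].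

Definition is_join (A B C : setcomp) :=
  [&& refines A C, refines B C &
      [forall D, refines A D ==> refines B D ==> refines C D]].

Lemma wparts_subproof (b : 'S_n) : (size [seq [set x] | x <- letters b] <= n)%N.
Proof. by rewrite size_map size_letters. Qed.

Definition wparts (b : 'S_n) : n.-bseq {set 'I_n} := Bseq (wparts_subproof b).

Lemma is_setcomp_wparts b : is_setcomp (wparts b).
Proof.
rewrite /is_setcomp map_inj_uniq ?letters_uniq /=; last exact: set1_inj.
apply/and3P; split.
- rewrite eqEsubset subsetT; apply/subsetP => x _; apply/bigcupP.
  by exists [set x]; rewrite ?inE // map_f ?mem_letters.
- apply/trivIsetP => P Q; rewrite !inE => /mapP[x _ ->] /mapP[y _ ->] xy.
  by rewrite disjoints1 inE; apply: contraNN xy => /eqP ->.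
- by rewrite inE; apply/mapP => -[x _ /setP/(_ x)]; rewrite !inE eqxx.
Qed.

Definition of_word (b : 'S_n) : setcomp := SetComp (is_setcomp_wparts b).

(* The default value is never used, see wjoinP. *)
Definition wjoin (b d : 'S_n) : setcomp :=
  odflt (of_word b) [pick A | is_join (of_word b) (of_word d) A].

Definition lt_wrt (s : 'S_n) (x y : 'I_n) := ((s^-1)%g x < (s^-1)%g y)%N.

Definition increasing_within (b s : 'S_n) (P : {set 'I_n}) :=
  [forall i : 'I_n, forall j : 'I_n,
     [&& (i < j)%N, b i \in P & b j \in P] ==> lt_wrt s (b i) (b j)].

Definition is_max (s : 'S_n) (P : {set 'I_n}) x :=
  (x \in P) && [forall y in P, ~~ lt_wrt s x y].

Definition is_min (s : 'S_n) (P : {set 'I_n}) x :=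
  (x \in P) && [forall y in P, ~~ lt_wrt s y x].

(* max_s(P) >_s min_s(Q) *)
Definition max_gt_min (s : 'S_n) (P Q : {set 'I_n}) :=
  [exists x, exists y, [&& is_max s P x, is_min s Q y & lt_wrt s y x]].

Definition d_cond (a c b : 'S_n) :=
  let L := wjoin b (wcomp b c) in
  [&& all (increasing_within b (eps n)) L,
      all (increasing_within (wcomp b c) a) L &
      [forall i : 'I_n, (i.+1 < size L)%N ==>
         (max_gt_min (eps n) (nth set0 L i) (nth set0 L i.+1) ||
          max_gt_min a (nth set0 L i) (nth set0 L i.+1))]].

Definition d_coef (a c : 'S_n) : nat := #|[set b : 'S_n | d_cond a c b]|.

End SetCompositions.

Local Open Scope ring_scope.

Section PatrasReutenauer.

Definition lorder := {n : nat & 'S_n}.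

HB.instance Definition _ := Choice.on lorder.

Definition lo n (a : 'S_n) : lorder := Tagged (fun k => 'S_k) a.

Definition lo_one : lorder := lo (eps 0).

Definition lo_mul (u v : lorder) : lorder := lo (wcat (tagged u) (tagged v)).

Definition lo_seq (u : lorder) : seq nat := map val (letters (tagged u)).

Lemma size_lo_seq u : size (lo_seq u) = tag u.
Proof. by rewrite size_map size_letters. Qed.

Lemma lo_seq_inj : injective lo_seq.
Proof.
move=> u v e; have := congr1 size e; rewrite !size_lo_seq.
case: u v e => [m a] [n b] /= e mn; case: n / mn b e => b.
move/(inj_map val_inj) => e; congr existT; apply/permP => i.
by have/eq_in_map/(_ i) := e; apply; rewrite mem_enum.
Qed.

Lemma enum_ord_add m n : enum 'I_(m + n) =
  map (lshift n) (enum 'I_m) ++ map (@rshift m n) (enum 'I_n).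
Proof.
apply: (inj_map val_inj); rewrite val_enum_ord map_cat iotaD add0n.
congr (_ ++ _); rewrite -map_comp; first by rewrite -val_enum_ord; apply: eq_map.
by rewrite -{1}[m]addn0 iotaDl -val_enum_ord -map_comp; apply: eq_map.
Qed.

Lemma lo_seq_mul u v :
  lo_seq (lo_mul u v) = lo_seq u ++ [seq (tag u + x)%N | x <- lo_seq v].
Proof.
case: u v => [m a] [n b].
rewrite /lo_seq /= /letters enum_ord_add !map_cat -!(map_comp (wcat a b)).
rewrite -!(map_comp val) -(map_comp (addn m)).
congr (_ ++ _); apply: eq_map => i /=; rewrite permE /cat_fun.
- by rewrite -[lshift n i]/(unsplit (inl i)) unsplitK.
- by rewrite -[rshift m i]/(unsplit (inr i)) unsplitK.
Qed.

Lemma lo_mulA : associative lo_mul.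
Proof.
move=> u v w; apply: lo_seq_inj; rewrite !lo_seq_mul map_cat catA -!map_comp.
by congr (_ ++ _); apply: eq_map => x /=; rewrite addnA.
Qed.

Lemma lo_seq_one : lo_seq lo_one = [::].
Proof. by apply: size0nil; rewrite size_lo_seq. Qed.

Lemma lo_mul1 : left_id lo_one lo_mul.
Proof.
by move=> u; apply: lo_seq_inj; rewrite lo_seq_mul lo_seq_one map_id.
Qed.

Lemma lo_mulr1 : right_id lo_one lo_mul.
Proof. by move=> u; apply: lo_seq_inj; rewrite lo_seq_mul lo_seq_one cats0. Qed.

Lemma lo_unit u v : lo_mul u v = lo_one -> u = lo_one /\ v = lo_one.
Proof.
move/(congr1 lo_seq); rewrite lo_seq_mul lo_seq_one.
case eu: (lo_seq u) => //; case ev: (lo_seq v) => // _.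
by split; apply: lo_seq_inj; rewrite lo_seq_one.
Qed.

(* With this monoid structure on its basis, {malg k[lorder]} is canonically a
   k-algebra, whose product is the shifted concatenation. *)
HB.instance Definition _ := Choice_isMonomialDef.Build lorder
  lo_mulA lo_mul1 lo_mulr1 lo_unit.

Variable k : fieldType.

Definition PR : Type := {malg k[lorder]}.

HB.instance Definition _ := GRing.Lalgebra.on PR.

(* PR (x) PR, with basis the pairs u (x) v of basis elements. *)
Definition PR2 : Type := {malg k[(lorder * lorder)%type]}.

HB.instance Definition _ := GRing.Lmodule.on PR2.

Definition bas n (a : 'S_n) : PR := << lo a >>.

Definition lin_ext (I : choiceType) (V : lmodType k) (f : I -> V)
    (x : {malg k[I]}) : V :=
  \sum_(u <- msupp x) x@_u *: f u.

Definition coprod : PR -> PR2 :=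
  lin_ext (fun u : lorder =>
    \sum_(P : {set 'I_(tag u)})
       (<< (lo (st (tagged u) P), lo (st (tagged u) (~: P))) >> : PR2)).

Definition counit (x : PR) : k := x@_lo_one.

(* mu \o (f (x) g) \o Delta, for linear f and g *)
Definition convolution (f g : PR -> PR) (x : PR) : PR :=
  lin_ext (fun uv : lorder * lorder => f << uv.1 >> * g << uv.2 >>) (coprod x).

Definition is_antipode (S : {linear PR -> PR}) : Prop :=
  forall x, convolution S id x = (counit x)%:A /\
            convolution id S x = (counit x)%:A.

End PatrasReutenauer.

(* The join of two words exists. *)

Local Open Scope nat_scope.

Section JoinExists.
Variable T : finType.
Implicit Types (b d l : seq T) (A B : seq {set T}).

Definition coarsening b A :=
  exists2 bb, flatten bb = b & A = [seq [set x in l] | l <- bb].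

Lemma least_coarsening b d : uniq b -> perm_eq b d -> exists A,
  [/\ set0 \notin A, coarsening b A, coarsening d A &
      forall B, set0 \notin B -> coarsening b B -> coarsening d B ->
        exists2 ss, flatten ss = A & B = [seq \bigcup_(P <- s) P | s <- ss]].
Proof.
have [N] := ubnP (size b); elim: N => // N IHN in b d *; rewrite ltnS => leN ub bd.
have [b0|b_gt0] := posnP (size b).
  have d0 : d = [::] by apply: size0nil; rewrite -(perm_size bd).
  exists [::]; split=> //; [by exists [::]; rewrite // (size0nil b0)|by exists [::]|].
  move=> B B0 [[|l bb] /= eb eB] _; first by exists [::]; rewrite // eB.
  move: eb; rewrite (size0nil b0); case: l eB => // eB.
  by move: B0; rewrite eB inE negb_or => /andP[/eqP[]]; apply/setP=> x; rewrite !inE.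
have ud : uniq d by rewrite -(perm_uniq bd).
have ex : exists k, (0 < k) && perm_eq (take k b) (take k d).
  by exists (size b); rewrite b_gt0 take_size (perm_size bd) take_size.
case: (ex_minnP ex) => k /andP[k_gt0 bdk] min_k.
have bdk' : perm_eq (drop k b) (drop k d).
  rewrite -(perm_cat2l (take k b)) cat_take_drop; apply: perm_trans bd _.
  by rewrite -{1}(cat_take_drop k d) perm_cat2r perm_sym.
have lek : k <= size b.
  by apply: min_k; rewrite b_gt0 take_size (perm_size bd) take_size.
have [|A' [A'0 [bb' ebb' eA'] [dd' edd' eA''] minA']] := IHN _ (drop k d) _ (drop_uniq k ub) bdk'.
  by rewrite size_drop; apply: leq_trans leN; rewrite ltn_subrL k_gt0.
pose K := [set x in take k b].
have KE : K = [set x in take k d] by apply/setP=> x; rewrite !inE (perm_mem bdk).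
have Kn0 : K != set0.
  apply/set0Pn; rewrite /K; case: (b) b_gt0 => // x s _.
  by case: (k) k_gt0 => // m _; exists x; rewrite !inE eqxx.
exists (K :: A'); split.
- by rewrite inE negb_or eq_sym Kn0.
- by exists (take k b :: bb'); rewrite /= ?ebb' ?cat_take_drop // eA'.
- by exists (take k d :: dd'); rewrite /= ?edd' ?cat_take_drop // KE eA''.
move=> B B0 [[|l bb] /= eb eB] [[|l' dd] /= ed eB'].
- by rewrite -eb in b_gt0.
- by rewrite -eb in b_gt0.
- by rewrite eB in eB'.
rewrite eB in eB'; case: eB' => ell eB'.
have ul : uniq l by move: ub; rewrite -eb cat_uniq => /and3P[].
have ul' : uniq l' by move: ud; rewrite -ed cat_uniq => /and3P[].
have pl : perm_eq l l'.
  by apply: uniq_perm => // x; have /setP/(_ x) := ell; rewrite !inE.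
have l_gt0 : 0 < size l.
  rewrite lt0n; apply: contraNneq B0 => /size0nil l0.
  by rewrite eB l0 inE; apply/orP; left; apply/eqP/setP=> x; rewrite !inE.
have lekl : k <= size l.
  apply: min_k; rewrite l_gt0 -{1}eb take_size_cat //.
  by rewrite -ed take_size_cat // (perm_size pl).
have tkb : take k b = take k l by rewrite -eb takel_cat.
have tkd : take k d = take k l' by rewrite -ed takel_cat // -(perm_size pl).
have dkb : drop k b = drop k l ++ flatten bb.
  rewrite -eb drop_cat; case: ltnP => // le'; have -> : k = size l by apply/eqP; rewrite eqn_leq lekl.
  by rewrite subnn drop0 drop_size.
have dkd : drop k d = drop k l' ++ flatten dd.
  rewrite -ed drop_cat -(perm_size pl); case: ltnP => // le'.
  have -> : k = size l' by apply/eqP; rewrite eqn_leq -(perm_size pl) lekl.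
  by rewrite (perm_size pl) subnn drop0 drop_size.
have B'0 : set0 \notin [seq [set x in l] | l <- bb].
  by apply: contraNN B0; rewrite eB inE orbC => ->.
have pdl : drop k l =i drop k l'.
  have : perm_eq (take k l ++ drop k l) (take k l' ++ drop k l').
    by rewrite !cat_take_drop.
  rewrite -tkb -tkd => h; apply: perm_mem.
  by rewrite -(perm_cat2l (take k b)); apply: perm_trans h _; rewrite perm_cat2r perm_sym.
have [dl0|dln0] := eqVneq (drop k l) [::].
  have dl'0 : drop k l' = [::].
    by apply: size0nil; rewrite size_drop -(perm_size pl) -size_drop dl0.
  have [|||ss ess eBss] := minA' [seq [set x in l] | l <- bb] => //.
  - by exists bb; rewrite ?dkb ?dl0.
  - by exists dd; rewrite ?dkd ?dl'0.
  exists ([:: K] :: ss); rewrite /= ?ess // eB -eBss; congr (_ :: _).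
  by rewrite big_seq1 /K tkb -{1}(cat_take_drop k l) dl0 cats0.
have [|||[|s ss] ess eBss] := minA' ([set x in drop k l] :: [seq [set x in l] | l <- bb]).
- rewrite inE negb_or B'0 andbT eq_sym; apply/set0Pn.
  by case: (drop k l) dln0 => // x s _; exists x; rewrite !inE eqxx.
- by exists (drop k l :: bb); rewrite /= ?dkb.
- exists (drop k l' :: dd); rewrite /= ?dkd // eB'; congr (_ :: _).
  by apply/setP=> x; rewrite !inE pdl.
- by [].
case: eBss => es eBss; exists ((K :: s) :: ss); rewrite /= -?ess // eB eBss.
congr (_ :: _); rewrite big_cons -es; apply/setP=> x.
by rewrite !inE tkb -{1}(cat_take_drop k l) mem_cat.
Qed.

Lemma coarsening_disjoint b A : uniq b -> set0 \notin A -> coarsening b A ->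
  [/\ uniq A, size A <= size b, trivIset [set P in A]
    & forall x, x \in b -> exists2 P, P \in A & x \in P].
Proof.
move=> ub A0 [bb eb eA]; elim: bb => [|l bb IHbb] /= in b A ub A0 eb eA *.
  rewrite -eb eA; split=> //; apply/trivIsetP => P Q; by rewrite !inE.
move: ub A0; rewrite -eb eA cat_uniq inE negb_or => /and3P[ul dis ubb] /andP[l0 A0].
have [uA szA /trivIsetP tA cA] := IHbb _ _ ubb A0 erefl erefl.
have disP P : P \in [seq [set x in l] | l <- bb] -> [disjoint [set x in l] & P].
  case/mapP=> l' l'bb ->; rewrite -setI_eq0; apply/eqP/setP=> x; rewrite !inE.
  apply/negP=> /andP[xl xl']; case/hasP: dis; exists x => //.
  by apply/flattenP; exists l'.
split.
- rewrite /= uA andbT; apply: contraNN l0 => /disP.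
  by rewrite -setI_eq0 setIid eq_sym.
- rewrite /= size_cat -add1n leq_add // lt0n; apply: contraNneq l0 => /size0nil ->.
  by apply/eqP/setP=> x; rewrite !inE.
- apply/trivIsetP => P Q; rewrite !inE.
  case/orP=> [/eqP->|PA] /orP[/eqP->|QA]; rewrite ?eqxx // => PQ.
  + exact: disP.
  + by rewrite disjoint_sym; apply: disP.
  + by apply: tA; rewrite ?inE.
- move=> x; rewrite mem_cat => /orP[xl|/cA[P PA xP]].
    by exists [set x in l]; rewrite ?inE ?eqxx ?xl.
  by exists P; rewrite // inE PA orbT.
Qed.

End JoinExists.

Section JoinCorrect.
Variable n : nat.
Implicit Types (A B C : setcomp n) (b d : 'S_n).

Lemma refinesP A B : reflect
  (exists2 ss, flatten ss = A & parts B = [seq \bigcup_(P <- s) P | s <- ss] :> seq _)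
  (refines A B).
Proof.
apply: (iffP existsP) => [[sh /andP[/eqP szA /eqP eB]]|[ss eA eB]].
  by exists (reshape (map val sh) A) => //; rewrite reshapeKr ?szA.
have sz : size (map (@inord n) (shape ss)) == size B.
  by rewrite eB !size_map.
exists (Tuple sz).
have -> : map val (Tuple sz) = shape ss.
  rewrite /= -map_comp -[RHS]map_id; apply/eq_in_map => i iss /=; rewrite inordK //.
  rewrite ltnS; apply: leq_trans (size_bseq A); rewrite -eA size_flatten.
  elim: (shape ss) iss => //= j s IHs; rewrite inE => /predU1P[->|/IHs le_i].
    exact: leq_addr.
  exact: leq_trans le_i (leq_addl _ _).
by rewrite -size_flatten -eA flattenK eB !eqxx.
Qed.

Lemma refines_wordP b (B : setcomp n) :
  reflect (coarsening (letters b) B) (refines (of_word b) B).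
Proof.
have U (l : seq 'I_n) : \bigcup_(P <- map set1 l) P = [set x in l].
  by apply/setP=> x; rewrite big_map; elim: l => [|y l IHl];
    rewrite ?big_nil ?big_cons !inE // IHl inE.
apply: (iffP (refinesP _ _)) => [[ss eA eB]|[bb eb eB]].
  exists (reshape (shape ss) (letters b)).
    by rewrite reshapeKr -?size_flatten ?eA /= ?size_map.
  rewrite eB -{1}[ss]flattenK eA /= -map_reshape -map_comp.
  by apply: eq_map => l /=; rewrite U.
exists (map (map set1) bb); first by rewrite -map_flatten eb.
by rewrite eB -map_comp; apply: eq_map => l /=; rewrite U.
Qed.

Lemma setcomp0 (A : setcomp n) : set0 \notin (A : seq {set 'I_n}).
Proof. by case: A => A /= /andP[_ /and3P[_ _]]; rewrite inE. Qed.

Lemma wjoinP b d : is_join (of_word b) (of_word d) (wjoin b d).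
Proof.
rewrite /wjoin; case: pickP => //= noA.
have pbd : perm_eq (letters b) (letters d).
  by apply: uniq_perm; rewrite ?letters_uniq // => x; rewrite !mem_letters.
have [A [A0 bA dA minA]] := least_coarsening (letters_uniq b) pbd.
have [uA szA tA cA] := coarsening_disjoint (letters_uniq b) A0 bA.
rewrite size_letters in szA.
have AP : is_setcomp (Bseq szA).
  rewrite /is_setcomp uA /=; apply/and3P; split=> //; last by rewrite in_set.
  rewrite eqEsubset subsetT; apply/subsetP=> x _.
  have [P PA xP] := cA x (mem_letters b x).
  by apply/bigcupP; exists P; rewrite ?inE.
have := noA (SetComp AP) => /negP[]; apply/and3P; split.
- exact/refines_wordP.
- exact/refines_wordP.
apply/forallP=> D; apply/implyP=> /refines_wordP bD; apply/implyP=> /refines_wordP dD.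
by apply/refinesP; apply: minA => //; apply: setcomp0.
Qed.

End JoinCorrect.

(* PR has an antipode, so that is_antipode is satisfiable. *)

Local Open Scope ring_scope.

Section Antipode.

Lemma enum_val_st n (a : 'S_n) (P : {set 'I_n}) i :
  enum_val (st a P i) = tnth (subword_tuple a P) i.
Proof. by rewrite permE enum_rankK_in ?mem_subword_tuple. Qed.

Lemma letters_st n (a : 'S_n) (P : {set 'I_n}) :
  map enum_val (letters (st a P)) = subword a P.
Proof.
rewrite -map_comp -[RHS]/(tval (subword_tuple a P)).
rewrite -[in RHS](map_tnth_enum (subword_tuple a P)).
by apply: eq_map => i; apply: enum_val_st.
Qed.

Lemma enum_val_mono n (P : {set 'I_n}) (i j : 'I_#|P|) :
  (i < j)%N -> (enum_val i < enum_val j)%N.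
Proof.
move=> ij; have x0 := enum_val i.
have : sorted ltn (map val (enum P)).
  apply: (subseq_sorted ltn_trans (s2 := map val (enum 'I_n))).
    by rewrite map_subseq // enumT /= /enum_mem filter_subseq.
  by rewrite val_enum_ord iota_ltn_sorted.
move/(sorted_ltn_nth ltn_trans 0%N)/(_ i j).
rewrite !inE size_map -cardE !ltn_ord => /(_ isT isT ij).
by rewrite !(nth_map x0) -?cardE ?ltn_ord // !(enum_val_nth x0).
Qed.

Lemma lo_st_eq m n (a : 'S_n) (b : 'S_m) (P : {set 'I_n}) (f : 'I_m -> 'I_n) :
  (forall i j : 'I_m, (i < j)%N -> (f i < f j)%N) ->
  map f (letters b) = subword a P -> lo b = lo (st a P).
Proof.
move=> f_mono fb.
have f_inj : injective f.
  move=> i j fij; apply: val_inj => /=; case: (ltngtP i j) => // /f_mono;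
    by rewrite fij ltnn.
have eP : map f (enum 'I_m) = enum P.
  apply: (inj_map val_inj); apply: (irr_sorted_eq ltn_trans ltnn).
  - rewrite -map_comp; have := iota_ltn_sorted 0 m; rewrite -val_enum_ord.
    rewrite !sorted_map; apply: sub_sorted => i j /=; exact: f_mono.
  - apply: (subseq_sorted ltn_trans (s2 := map val (enum 'I_n))).
      by rewrite map_subseq // enumT /= /enum_mem filter_subseq.
    by rewrite val_enum_ord iota_ltn_sorted.
  have memP x : (x \in map f (enum 'I_m)) = (x \in enum P).
    have -> : (x \in enum P) = (x \in subword a P).
      by rewrite mem_enum mem_filter mem_letters andbT.
    rewrite -fb; apply/mapP/mapP => -[y _ ->].
      by exists y; rewrite ?mem_letters.
    by exists y; rewrite ?mem_enum.
  exact: eq_mem_map.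
have em : m = #|P| by rewrite cardE -eP size_map size_enum_ord.
apply: lo_seq_inj; rewrite /lo_seq /=.
have idx (i : 'I_#|P|) : val i = index (enum_val i) (enum P).
  by rewrite (enum_val_nth (enum_val i)) index_uniq ?enum_uniq // -cardE.
rewrite (eq_map idx) (map_comp (fun x => index x (enum P)) enum_val) letters_st -fb.
rewrite -[RHS](map_comp _ f); apply: eq_map => i /=.
by rewrite -eP index_map // index_enum_ord.
Qed.

Lemma lo_st_setT n (a : 'S_n) : lo (st a setT) = lo a.
Proof.
apply/esym/(@lo_st_eq _ _ _ _ _ id) => //.
by rewrite map_id /subword (eq_filter (a2 := predT)) ?filter_predT // => x; rewrite inE.
Qed.

Lemma lo_st0 n (a : 'S_n) (P : {set 'I_n}) : #|P| = 0%N -> lo (st a P) = lo_one.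
Proof. by move=> P0; apply: lo_seq_inj; rewrite lo_seq_one; apply: size0nil; rewrite size_lo_seq. Qed.

Lemma lo_st_st n (a : 'S_n) (P : {set 'I_n}) (Q : {set 'I_#|P|}) :
  lo (st (st a P) Q) = lo (st a (enum_val @: Q)).
Proof.
apply: (lo_st_eq (f := enum_val \o enum_val)).
  by move=> i j ij /=; do 2!apply: enum_val_mono.
rewrite map_comp letters_st /subword.
have e (x : 'I_#|P|) : (x \in Q) = (enum_val x \in enum_val @: Q).
  by rewrite mem_imset //; apply: enum_val_inj.
rewrite (eq_filter e) -filter_map letters_st -filter_predI.
apply: eq_filter => x /=; apply: andb_idr => /imsetP[y _ ->]; exact: enum_valP.
Qed.

Variable k : fieldType.
Implicit Types f g h : lorder -> PR k.

Definition bconv f g (u : lorder) : PR k :=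
  \sum_(P : {set 'I_(tag u)})
     f (lo (st (tagged u) P)) * g (lo (st (tagged u) (~: P))).

Lemma bconv_st f g n (a : 'S_n) (P : {set 'I_n}) :
  bconv f g (lo (st a P)) =
  \sum_(U : {set 'I_n} | U \subset P) f (lo (st a U)) * g (lo (st a (P :\: U))).
Proof.
rewrite /bconv /= (reindex_onto (fun Q : {set 'I_#|P|} => enum_val @: Q)
                                (fun U => enum_val @^-1: U)) /=; last first.
  move=> U /subsetP UP; apply/setP=> x; apply/imsetP/idP.
    by case=> y; rewrite inE => yU ->.
  by move=> xU; exists (enum_rank_in (UP x xU) x); rewrite ?inE enum_rankK_in ?UP.
apply: eq_big => [Q|Q _].
  have -> : enum_val @: Q \subset P.
    by apply/subsetP=> x /imsetP[y _ ->]; apply: enum_valP.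
  apply/esym/eqP/setP=> x; rewrite inE mem_imset //; exact: enum_val_inj.
rewrite !lo_st_st; congr (_ * g (lo (st a _))).
apply/setP=> x; rewrite inE; apply/imsetP/andP.
  case=> y; rewrite inE => yQ ->; split; last exact: enum_valP.
  by rewrite mem_imset //; apply: enum_val_inj.
case=> xQ xP; exists (enum_rank_in xP x); last by rewrite enum_rankK_in.
rewrite inE; apply: contraNN xQ => xQ.
by rewrite -[x](enum_rankK_in xP) // imset_f.
Qed.

Lemma bconvA f g h u : bconv f (bconv g h) u = bconv (bconv f g) h u.
Proof.
case: u => n a; rewrite [LHS]/bconv [RHS]/bconv /=.
under eq_bigr do rewrite bconv_st mulr_sumr.
under [RHS]eq_bigr do rewrite bconv_st mulr_suml.
rewrite [RHS](exchange_big_dep predT) //=; apply: eq_bigr => U _.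
rewrite (reindex_onto (fun P => P :\: U) (fun V => U :|: V)) /=; last first.
  move=> V /subsetP VU; apply/setP=> x; rewrite !inE; have := VU x.
  by rewrite !inE; case: (x \in V); case: (x \in U) => // /(_ isT).
apply: eq_big => [P|P /andP[_ /eqP UP]].
  rewrite setDE subsetIr /=; apply/eqP/idP => [<-|UP]; first exact: subsetUl.
  apply/setP=> x; rewrite !inE; have := subsetP UP x.
  by case: (x \in U) => [/(_ isT)->|_] //=; rewrite andbT.
rewrite mulrA; congr (_ * h (lo (st a _))).
by apply/setP=> x; rewrite -UP !inE; case: (x \in U); case: (x \in P).
Qed.

Definition bunit (u : lorder) : PR k := (tag u == 0%N)%:R.

Lemma bconv1l f u : bconv bunit f u = f u.
Proof.
case: u => n a; rewrite /bconv (bigD1 set0) //= big1 ?addr0.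
  by rewrite /bunit /= cards0 mul1r setC0 lo_st_setT.
by move=> P P0; rewrite /bunit /= cards_eq0 (negPf P0) mul0r.
Qed.

Lemma bconv1r f u : bconv f bunit u = f u.
Proof.
case: u => n a; rewrite /bconv (bigD1 setT) //= big1 ?addr0.
  by rewrite /bunit /= setCT cards0 mulr1 lo_st_setT.
move=> P P0; rewrite /bunit /= cards_eq0 -setCT (inj_eq (@setC_inj _)).
by rewrite (negPf P0) mulr0.
Qed.

Definition bid (u : lorder) : PR k := << u >>.

Fixpoint SL_rec N (u : lorder) : PR k :=
  if tag u == 0%N then 1 else
  if N is N'.+1 then
    - \sum_(P : {set 'I_(tag u)} | P != setT)
        SL_rec N' (lo (st (tagged u) P)) * bid (lo (st (tagged u) (~: P)))
  else 0.

Fixpoint SR_rec N (u : lorder) : PR k :=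
  if tag u == 0%N then 1 else
  if N is N'.+1 then
    - \sum_(P : {set 'I_(tag u)} | P != set0)
        bid (lo (st (tagged u) P)) * SR_rec N' (lo (st (tagged u) (~: P)))
  else 0.

Lemma SL_recE M N u : (tag u <= M)%N -> (tag u <= N)%N -> SL_rec M u = SL_rec N u.
Proof.
have z K v : tag v = 0%N -> SL_rec K v = 1 by case: K => [|K] /eqP v0; rewrite /= ifT.
elim: M N u => [|M IHM] [|N] u.
- by move=> u0 _; rewrite !z //; apply/eqP; rewrite -leqn0.
- by move=> u0 _; rewrite !z //; apply/eqP; rewrite -leqn0.
- by move=> _ u0; rewrite !z //; apply/eqP; rewrite -leqn0.
move=> uM uN; rewrite /=; case: (tag u == 0%N); first by [].
congr (- _); apply: eq_bigr => P PT; congr (_ * _).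
have lt : (#|P| < tag u)%N.
  rewrite -[X in (_ < X)%N]card_ord -cardsT; apply: proper_card.
  by rewrite properT.
by apply: IHM; rewrite /= -ltnS; apply: leq_trans lt _.
Qed.

Lemma SR_recE M N u : (tag u <= M)%N -> (tag u <= N)%N -> SR_rec M u = SR_rec N u.
Proof.
have z K v : tag v = 0%N -> SR_rec K v = 1 by case: K => [|K] /eqP v0; rewrite /= ifT.
elim: M N u => [|M IHM] [|N] u.
- by move=> u0 _; rewrite !z //; apply/eqP; rewrite -leqn0.
- by move=> u0 _; rewrite !z //; apply/eqP; rewrite -leqn0.
- by move=> _ u0; rewrite !z //; apply/eqP; rewrite -leqn0.
move=> uM uN; rewrite /=; case: (tag u == 0%N); first by [].
congr (- _); apply: eq_bigr => P PT; congr (_ * _).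
have lt : (#|~: P| < tag u)%N.
  rewrite -[X in (_ < X)%N]card_ord -cardsT; apply: proper_card.
  by rewrite properT -setC0 (inj_eq (@setC_inj _)).
by apply: IHM; rewrite /= -ltnS; apply: leq_trans lt _.
Qed.

Definition SL u := SL_rec (tag u) u.
Definition SR u := SR_rec (tag u) u.

Lemma bid_one : bid lo_one = 1. Proof. by []. Qed.

Lemma SL_conv u : bconv SL bid u = bunit u.
Proof.
case: u => n a; rewrite /bconv /bunit /= (bigD1 setT) //= lo_st_setT setCT.
rewrite (lo_st0 a (cards0 _)) bid_one mulr1 {1}/SL.
case: n a => [|n] a /=.
  by rewrite big1 ?addr0 // => P /eqP[]; apply/setP=> -[].
apply/eqP; rewrite addrC subr_eq0; apply/eqP/eq_bigr => P PT.
congr (_ * _); apply: SL_recE => //=; rewrite -ltnS -[X in (_ < X)%N]card_ord.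
by rewrite -cardsT proper_card // properT.
Qed.

Lemma SR_conv u : bconv bid SR u = bunit u.
Proof.
case: u => n a; rewrite /bconv /bunit /= (bigD1 set0) //= setC0 lo_st_setT.
rewrite (lo_st0 a (cards0 _)) bid_one mul1r {1}/SR.
case: n a => [|n] a /=.
  by rewrite big1 ?addr0 // => P /eqP[]; apply/setP=> -[].
apply/eqP; rewrite addrC subr_eq0; apply/eqP/eq_bigr => P P0.
congr (_ * _); apply: SR_recE => //=; rewrite -ltnS -[X in (_ < X)%N]card_ord.
by rewrite -cardsT proper_card // properT -setC0 (inj_eq (@setC_inj _)).
Qed.

Lemma eq_bconv f f' g g' : f =1 f' -> g =1 g' -> bconv f g =1 bconv f' g'.
Proof. by move=> ff gg u; apply: eq_bigr => P _; rewrite ff gg. Qed.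

Lemma SLR : SL =1 SR.
Proof.
move=> u; rewrite -[LHS]bconv1r -(eq_bconv (frefl _) SR_conv) bconvA.
by rewrite (eq_bconv SL_conv (frefl _)) bconv1l.
Qed.

Lemma lin_ext_sub (I : choiceType) (V : lmodType k) (F : I -> V)
    (D : {fset I}) (x : {malg k[I]}) :
  (msupp x `<=` D)%fset -> lin_ext F x = \sum_(u <- D) x@_u *: F u.
Proof.
move=> xD; rewrite /lin_ext; apply: big_fset_incl => // u _.
by rewrite -mcoeff_eq0 => /eqP->; rewrite scale0r.
Qed.

Lemma lin_ext_linear (I : choiceType) (V : lmodType k) (F : I -> V) :
  linear (lin_ext F).
Proof.
move=> c x y; pose D := (msupp x `|` msupp y `|` msupp (c *: x + y))%fset.
rewrite !(lin_ext_sub F (D := D)).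
- rewrite scaler_sumr -big_split /=; apply: eq_bigr => u _.
  by rewrite mcoeffD mcoeffZ scalerDl scalerA.
- by rewrite /D -fsetUA (fsubset_trans _ (fsubsetUr _ _)) // fsubsetUl.
- by rewrite /D -fsetUA fsubsetUl.
- by rewrite /D fsubsetUr.
Qed.

HB.instance Definition _ (I : choiceType) (V : lmodType k) (F : I -> V) :=
  GRing.isLinear.Build k {malg k[I]} V _ (lin_ext F) (lin_ext_linear F).

Lemma lin_extU (I : choiceType) (V : lmodType k) (F : I -> V) u :
  lin_ext F << u >> = F u.
Proof.
by rewrite /lin_ext msuppU oner_eq0 big_seq_fset1 mcoeffUU scale1r.
Qed.

Lemma bunitE u : bunit u = (u == lo_one)%:R.
Proof.
rewrite /bunit; congr (nat_of_bool _)%:R; apply/eqP/eqP => [u0|-> //].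
by apply: lo_seq_inj; rewrite lo_seq_one; apply: size0nil; rewrite size_lo_seq.
Qed.

Lemma lin_ext_bunit (x : PR k) : lin_ext bunit x = (counit x)%:A.
Proof.
rewrite (lin_ext_sub _ (D := (lo_one |` msupp x)%fset)) ?fsubsetUr //.
rewrite (big_fsetD1 lo_one) ?fset1U1 //= big_seq big1 ?addr0.
  by rewrite bunitE eqxx.
by move=> u; rewrite in_fsetD1 => /andP[/negPf u1 _]; rewrite bunitE u1 scaler0.
Qed.

Lemma convolutionE (F G : PR k -> PR k) x :
  convolution F G x = lin_ext (bconv (F \o bid) (G \o bid)) x.
Proof.
rewrite /convolution /coprod [X in lin_ext _ X]/lin_ext linear_sum.
apply: eq_bigr => u _; rewrite linearZ /=; congr (_ *: _).
by rewrite linear_sum; apply: eq_bigr => P _; apply: lin_extU.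
Qed.

Lemma antipode_exists : exists S : {linear PR k -> PR k}, is_antipode S.
Proof.
exists (lin_ext SL : {linear PR k -> PR k}) => x; rewrite !convolutionE.
have SE : lin_ext SL \o bid =1 SL by move=> u; apply: lin_extU.
by split; rewrite -lin_ext_bunit; apply: eq_bigr => u _; congr (_ *: _);
  rewrite ?(eq_bconv SE (frefl _)) ?(eq_bconv (frefl _) SE) -?SL_conv //
    (eq_bconv (frefl _) SLR) SR_conv SL_conv.
Qed.

End Antipode.

(* Main.v *)
Require Import Defs.
From HB Require Import structures.
From mathcomp Require Import all_boot all_order all_algebra all_fingroup.
From mathcomp Require Import zify.
From mathcomp.multinomials Require Import monalg.

Set Implicit Arguments.
Unset Strict Implicit.
Unset Printing Implicit Defensive.

Import GRing.Theory.

Local Open Scope ring_scope.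

(* Iterating S(alpha) = - sum_(P != 0) alpha|_P . S(alpha|_(P^c)) would write
   S(alpha) as a sum over set compositions A of (-1)^l(A) times a word gamma.
   Encode A by the word b listing each part increasingly, the word d listing each
   part in the order of alpha (so that d = b o gamma), and the set C of the
   positions where the parts start.  Given b and d, the possible C are the sets
   between D and J, where D consists of 0, the descents of b and the
   alpha-descents of d, and J of the p such that the first p letters of b and of
   d form the same set.  The sum of (-1)^|C| over them vanishes unless D = J, when
   it is (-1)^|J|.  With these coefficients, the sum over the pairs (b, d) is
   inverse to the identity for convolution, because splitting off the first part
   telescopes.  Finally, J is the set of starts of the parts of b \/ d, so that
   |J| = l(eps \/ gamma), and D = J amounts to (i)-(iii). *)

(** * Signs of cuttings of a pair of words *)

Section CutFactors.
Variables (R : pzRingType) (J D : pred nat).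

(* The sum of (-1)^x over the booleans x with D p ==> x and x ==> J p. *)
Definition cut_factor p : R := if J p == D p then (-1) ^+ J p else 0.

Lemma prod_cut_factor (s : seq nat) :
  \prod_(p <- s) cut_factor p =
  if all (fun p => J p == D p) s then (-1) ^+ count J s else 0.
Proof.
elim: s => [|p s IHs]; rewrite ?big_nil // big_cons IHs /cut_factor /=.
case: ifP; rewrite ?mul0r //=; case: ifP; rewrite ?mulr0 // => _ _.
by rewrite exprD.
Qed.

(* The sum of (-1)^|C| over the cuttings C of the positions l, ..., N - 1 into
   blocks, l being in C unless l = N. *)
Definition tail_sign N l : R :=
  if l == N then 1 else - \prod_(l.+1 <= q < N) cut_factor q.

Lemma tail_sign_ltn N l : (l < N)%N ->
  tail_sign N l = - \prod_(l.+1 <= q < N) cut_factor q.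
Proof. by move=> lN; rewrite /tail_sign ltn_eqF. Qed.

(* The first block of a cutting ends at some p such that J p, with no point of D
   strictly before it; peeling off position l.+1 telescopes the sum over p. *)
Lemma sum_tail_sign N l : (l < N)%N -> J N ->
  \sum_(l.+1 <= p < N.+1 | J p && all (predC D) (iota l.+1 (p - l.+1)))
     tail_sign N p = - tail_sign N l.
Proof.
move=> + JN; have [M] := ubnP (N - l); elim: M l => // M IHM l NlM lN.
rewrite tail_sign_ltn // opprK big_mkcond big_ltn //= subnn /= andbT.
have [lN'|Nl] := ltnP l.+1 N; last first.
  have eN : l.+1 = N by lia.
  by rewrite eN JN /tail_sign eqxx !big_geq ?addr0.
have -> : \sum_(l.+2 <= p < N.+1)
    (if J p && all (predC D) (iota l.+1 (p - l.+1)) then tail_sign N p else 0) =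
    (~~ D l.+1)%:R * - tail_sign N l.+1.
  rewrite -IHM ?[in RHS]big_mkcond ?mulr_sumr; [|lia|by []].
  apply: eq_big_nat => p /andP[lp pN].
  have -> : (p - l.+1 = (p - l.+2).+1)%N by lia.
  by rewrite /=; case: (D _); rewrite /= ?andbF ?mul0r ?mul1r.
rewrite big_ltn // tail_sign_ltn // opprK /cut_factor -/cut_factor.
by case: (J l.+1); case: (D l.+1) => /=;
  rewrite ?expr1 ?expr0 ?mulN1r ?mul1r ?mul0r ?addr0 ?add0r ?addNr.
Qed.

End CutFactors.

Lemma perm_cat_cancel (T : eqType) (s1 s2 t1 t2 : seq T) : perm_eq s1 s2 ->
  perm_eq (s1 ++ t1) (s2 ++ t2) = perm_eq t1 t2.
Proof.
by move=> s12; rewrite (permPl (perm_cat s12 (perm_refl t1))) perm_cat2l.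
Qed.

Section Descents.
Variables (T : Type) (r : T -> nat).
Implicit Types w : seq T.

Definition rank_at w p := nth 0%N (map r w) p.

(* Position 0 always counts as a descent, since 0.-1 = 0. *)
Definition descent w : pred nat := fun p => (rank_at w p <= rank_at w p.-1)%N.

Lemma descent0 w : descent w 0. Proof. exact: leqnn. Qed.

Lemma descent_drop w p q : (0 < q)%N ->
  descent (drop p w) q = descent w (p + q).
Proof.
move=> q_gt0; rewrite /descent /rank_at map_drop !nth_drop.
by rewrite -subn1 addnBA // subn1.
Qed.

Lemma sorted_take_descent w p : (p <= size w)%N ->
  sorted ltn (map r (take p w)) = all (predC (descent w)) (iota 1 p.-1).
Proof.
move=> pw; apply/(sortedP 0%N)/allP => [w_lt q|no_desc q].
  rewrite mem_iota => /andP[q_gt0 qp]; rewrite /= -ltnNge.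
  have := w_lt q.-1; rewrite map_take size_takel ?size_map // prednK //.
  by rewrite !nth_take; [apply|..]; lia.
rewrite map_take size_takel ?size_map // => qp.
have := no_desc q.+1; rewrite mem_iota /= -ltnNge !nth_take; [|lia|lia].
by apply; lia.
Qed.

End Descents.

Section WordPairs.
Variables (T : eqType) (r1 r2 : T -> nat) (R : pzRingType).
Implicit Types b d : seq T.

Definition perm_take b d : pred nat := fun p => perm_eq (take p b) (take p d).

Definition pair_descent b d : pred nat :=
  fun p => descent r1 b p || descent r2 d p.

Definition cut_sign b d : R :=
  \prod_(0 <= p < size b) cut_factor R (perm_take b d) (pair_descent b d) p.

Lemma perm_take0 b d : perm_take b d 0.
Proof. by rewrite /perm_take !take0. Qed.

Lemma pair_descent0 b d : pair_descent b d 0.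
Proof. by rewrite /pair_descent descent0. Qed.

Lemma perm_take_drop b d p q : perm_take b d p ->
  perm_take (drop p b) (drop p d) q = perm_take b d (p + q).
Proof. by move=> bdp; rewrite /perm_take !takeD perm_cat_cancel. Qed.

Lemma cut_sign_drop b d p : (p <= size b)%N -> perm_take b d p ->
  cut_sign (drop p b) (drop p d) =
  tail_sign R (perm_take b d) (pair_descent b d) (size b) p.
Proof.
move=> pb bdp; rewrite /cut_sign size_drop /tail_sign.
case: eqP => [->|pNb]; first by rewrite subnn big_geq.
rewrite big_ltn; last by lia.
rewrite {1}/cut_factor perm_take0 pair_descent0 expr1 mulN1r; congr (- _).
rewrite -[in RHS](add0n p.+1) -addSnnS [RHS]big_addn.
apply: eq_big_nat => q /andP[q_gt0 _]; rewrite /cut_factor perm_take_drop //.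
by rewrite /pair_descent !descent_drop // addnC.
Qed.

(* p is 0 or the end of the first block of a cutting of (b, d). *)
Lemma sum_cut_sign_drop b d : perm_eq b d ->
  \sum_(p < (size b).+1 | [&& perm_take b d p,
      sorted ltn (map r1 (take p b)) & sorted ltn (map r2 (take p d))])
    cut_sign (drop p b) (drop p d) = (b == [::])%:R.
Proof.
move=> bd; have sbd := perm_size bd; set N := size b.
pose J := perm_take b d; pose D := pair_descent b d.
transitivity (\sum_(0 <= p < N.+1 | J p && all (predC D) (iota 1 p.-1))
                tail_sign R J D N p).
  rewrite big_mkord; apply: eq_big => p; have := ltn_ord p; rewrite ltnS => pN.
    rewrite !sorted_take_descent -?sbd // -all_predI; congr (_ && _).
    by apply: eq_all => q /=; rewrite -negb_or.
  by case/andP=> Jp _; rewrite cut_sign_drop.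
have JN : J N by rewrite /J /perm_take take_size /N sbd take_size.
rewrite big_mkcond big_ltn //= /J perm_take0 /= -/J -size_eq0 -/N.
have [N0|N_gt0] := posnP N; first by rewrite N0 big_geq // addr0.
rewrite -big_mkcond /=; under eq_bigl do rewrite -subn1.
by rewrite sum_tail_sign // subrr.
Qed.

End WordPairs.

(** * Relative positions in words *)

Section RelativePositions.

Definition lo_of_seq (s : seq nat) : lorder :=
  if [pick a : 'S_(size s) | lo_seq (lo a) == s] is Some a then lo a
  else lo_one.

Lemma lo_seqK : cancel lo_seq lo_of_seq.
Proof.
move=> u; move: {-2}(lo_seq u) (erefl (lo_seq u)) => s uE; rewrite /lo_of_seq.
case: pickP => [a /eqP aE|no_word]; first by apply: lo_seq_inj; rewrite aE uE.
case: u uE => n a uE; have n_size : n = size s by rewrite uE size_lo_seq.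
by subst n; have := no_word a; rewrite {2}uE eqxx.
Qed.

Lemma lo_of_seqK s : perm_eq s (iota 0 (size s)) -> lo_seq (lo_of_seq s) = s.
Proof.
move=> s_iota; suff [u <-] : exists u, lo_seq u = s by rewrite lo_seqK.
have s_lt (i : 'I_(size s)) : (nth 0 s i < size s)%N.
  by have := mem_nth 0 (ltn_ord i); rewrite (perm_mem s_iota) mem_iota.
have s_inj : injective (fun i => Ordinal (s_lt i)).
  move=> i j [] /eqP; rewrite nth_uniq // ?(perm_uniq s_iota) ?iota_uniq //.
  by move/eqP/val_inj.
exists (lo (perm s_inj)); rewrite /lo_seq /letters /= -map_comp.
apply: (@eq_from_nth _ 0%N); rewrite size_map size_enum_ord // => i i_lt.
by rewrite (nth_map (Ordinal i_lt)) ?size_enum_ord //= permE /= nth_enum_ord.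
Qed.

(* For words b and d on the same letters, the word g such that d = b o g. *)
Definition index_word (T : eqType) (b d : seq T) : lorder :=
  lo_of_seq [seq index x b | x <- d].

Lemma map_index_id (T : eqType) (b : seq T) : uniq b ->
  [seq index x b | x <- b] = iota 0 (size b).
Proof.
move=> b_uniq.
apply: (@eq_from_nth _ 0%N); rewrite size_map ?size_iota // => i i_lt.
have x0 : T by case: (b) i_lt.
by rewrite (nth_map x0) // index_uniq // nth_iota.
Qed.

Lemma index_wordK (T : eqType) (b d : seq T) : uniq b -> perm_eq b d ->
  lo_seq (index_word b d) = [seq index x b | x <- d].
Proof.
move=> b_uniq bd; apply: lo_of_seqK; rewrite size_map -(perm_size bd).
by rewrite -map_index_id // perm_map // perm_sym.
Qed.

End RelativePositions.

Section Letters.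
Variable n : nat.
Implicit Types (s a b c : 'S_n) (P : {set 'I_n}) (w : seq 'I_n).

Definition letter_rank s (x : 'I_n) : nat := (s^-1)%g x.

Lemma letter_rankK s (x : 'I_n) : letter_rank s (s x) = x.
Proof. by rewrite /letter_rank permK. Qed.

Lemma letter_rank_inj s : injective (letter_rank s).
Proof. by move=> x y /val_inj/perm_inj. Qed.

Lemma map_letter_rank s : map (letter_rank s) (letters s) = iota 0 n.
Proof.
by rewrite -map_comp -val_enum_ord; apply: eq_map => i; apply: letter_rankK.
Qed.

Lemma rank_at_letters s a (x : 'I_n) :
  rank_at (letter_rank s) (letters a) x = letter_rank s (a x).
Proof.
rewrite /rank_at (nth_map x) ?size_letters // (nth_map x) ?size_enum_ord //.
by rewrite nth_ord_enum.
Qed.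

Lemma letters_inj : injective (@letters n).
Proof.
move=> a b ab; apply/permP => i.
by have/eq_in_map/(_ i) := ab; apply; rewrite mem_enum.
Qed.

Lemma perm_letters a b : perm_eq (letters a) (letters b).
Proof.
by apply: uniq_perm; rewrite ?letters_uniq // => x; rewrite !mem_letters.
Qed.

Lemma letters_eps : letters (eps n) = enum 'I_n.
Proof. by rewrite /letters (eq_map (@perm1 _)) map_id. Qed.

Lemma letters_wcomp b c : letters (wcomp b c) = map b (letters c).
Proof.
by rewrite /letters -[RHS]map_comp; apply: eq_map => i; rewrite wcompE.
Qed.

Lemma index_letters a (x : 'I_n) : index (a x) (letters a) = x.
Proof. by rewrite /letters index_map ?index_enum_ord //; apply: perm_inj. Qed.

Lemma index_word_wcomp b c :
  index_word (letters b) (letters (wcomp b c)) = lo c.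
Proof.
rewrite -[RHS]lo_seqK; congr lo_of_seq; rewrite letters_wcomp -map_comp.
by apply: eq_map => i /=; rewrite index_letters.
Qed.

Lemma perm_take_wcomp b c :
  perm_take (letters b) (letters (wcomp b c)) =1
  perm_take (letters (eps n)) (letters c).
Proof.
move=> p; have -> : letters b = map b (letters (eps n)) by rewrite letters_eps.
rewrite letters_wcomp /perm_take -!map_take.
apply/idP/idP; last exact: perm_map.
exact/perm_map_inj/perm_inj.
Qed.

Lemma mem_subword a P x : (x \in subword a P) = (x \in P).
Proof. by rewrite mem_filter mem_letters andbT. Qed.

Lemma subword_uniq a P : uniq (subword a P).
Proof. by rewrite filter_uniq ?letters_uniq. Qed.

Lemma perm_subword a b P : perm_eq (subword a P) (subword b P).
Proof. exact/perm_filter/perm_letters. Qed.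

Lemma subword_eps P : subword (eps n) P = enum P.
Proof. by rewrite /subword letters_eps [in RHS]/enum_mem -enumT. Qed.

Lemma sorted_subword s P : sorted ltn (map (letter_rank s) (subword s P)).
Proof.
apply: (subseq_sorted ltn_trans (s2 := map (letter_rank s) (letters s))).
  by rewrite map_subseq // filter_subseq.
by rewrite map_letter_rank iota_ltn_sorted.
Qed.

Lemma eq_subword s P w :
  w =i P -> sorted ltn (map (letter_rank s) w) -> w = subword s P.
Proof.
move=> wP w_sorted; apply: (inj_map (@letter_rank_inj s)).
apply: (irr_sorted_eq ltn_trans ltnn) => //; first exact: sorted_subword.
by apply: eq_mem_map => x; rewrite mem_subword wP.
Qed.

Lemma lo_seq_st a P :
  lo_seq (lo (st a P)) = [seq index x (enum P) | x <- subword a P].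
Proof.
have rank_index (i : 'I_#|P|) : val i = index (enum_val i) (enum P).
  by rewrite (enum_val_nth (enum_val i)) index_uniq ?enum_uniq // -cardE.
by rewrite /lo_seq (eq_map rank_index) (map_comp (index^~ (enum P))) letters_st.
Qed.

Lemma lo_mul_index_word a P (b d : seq 'I_n) :
  uniq (enum P ++ b) -> perm_eq b d ->
  lo_mul (lo (st a P)) (index_word b d) =
  index_word (subword (eps n) P ++ b) (subword a P ++ d).
Proof.
move=> Pb_uniq bd; have := Pb_uniq.
rewrite cat_uniq => /and3P[_ /hasPn PNb b_uniq].
have P_subword : perm_eq (enum P) (subword a P).
  by rewrite -subword_eps perm_subword.
apply: lo_seq_inj; rewrite subword_eps lo_seq_mul lo_seq_st.
rewrite !index_wordK //; last first.
  exact: perm_cat.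
rewrite map_cat -map_comp; congr (_ ++ _); apply/eq_in_map => x x_in /=.
  by rewrite index_cat (perm_mem P_subword) x_in.
have := PNb x; rewrite (perm_mem bd) x_in => /(_ isT) /negbTE xP.
by rewrite index_cat xP -cardE.
Qed.

End Letters.

(** * The antipode as a signed sum over pairs of words *)

Section SetWords.
Variable T : finType.
Implicit Types (P Q : {set T}) (b w : seq T).

Definition set_words Q : seq (seq T) := permutations (enum Q).

Lemma set_wordsP Q b : reflect (uniq b /\ b =i Q) (b \in set_words Q).
Proof.
rewrite mem_permutations; apply: (iffP idP) => [bQ|[b_uniq bQ]].
  rewrite (perm_uniq bQ) enum_uniq; split=> // x.
  by rewrite (perm_mem bQ) mem_enum.
by apply: uniq_perm => // [|x]; rewrite ?enum_uniq // bQ mem_enum.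
Qed.

Lemma set_words0 : set_words set0 = [:: [::]].
Proof. by rewrite /set_words enum_set0. Qed.

Lemma perm_set_words Q b d :
  b \in set_words Q -> d \in set_words Q -> perm_eq b d.
Proof.
by rewrite !mem_permutations => bQ dQ; rewrite (permPl bQ) perm_sym.
Qed.

Lemma size_set_words Q b : b \in set_words Q -> size b = #|Q|.
Proof. by rewrite mem_permutations => /perm_size ->; rewrite cardE. Qed.

Lemma cat_set_words P Q w b : P \subset Q -> w \in set_words P ->
  (w ++ b \in set_words Q) = (b \in set_words (Q :\: P)).
Proof.
move=> PQ /set_wordsP[w_uniq wP]; apply/set_wordsP/set_wordsP => -[].
  rewrite cat_uniq => /and3P[_ /hasPn bNw b_uniq] wbQ; split=> // x.
  rewrite inE -wP -wbQ mem_cat; case: (boolP (x \in w)) => // xw.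
  by apply/negbTE; apply: contraTN xw => /bNw.
move=> b_uniq bQP; split=> [|x].
  rewrite cat_uniq w_uniq b_uniq andbT; apply/hasPn => x.
  by rewrite bQP inE wP => /andP[].
rewrite mem_cat wP bQP inE; case: (boolP (x \in P)) => //= xP.
by rewrite (subsetP PQ).
Qed.

Lemma big_set_words_prefix (V : nmodType) (f : seq T -> V) w P Q :
  w \in set_words P -> P \subset Q ->
  \sum_(b <- set_words Q | take #|P| b == w) f b =
  \sum_(b <- set_words (Q :\: P)) f (w ++ b).
Proof.
move=> wP PQ; rewrite -big_filter -[RHS](big_map (cat w) predT f).
apply/perm_big/uniq_perm.
- by rewrite filter_uniq ?permutations_uniq.
- rewrite map_inj_uniq ?permutations_uniq // => x y /eqP.
  by rewrite eqseq_cat // => /andP[_ /eqP].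
move=> b; rewrite mem_filter.
apply/andP/mapP => [[/eqP take_b bQ]|[b' b'QP ->]].
- have b_cat : w ++ drop #|P| b = b by rewrite -take_b cat_take_drop.
  by exists (drop #|P| b); rewrite // -(cat_set_words _ PQ wP) b_cat.
- by rewrite (cat_set_words _ PQ wP) take_size_cat ?(size_set_words wP).
Qed.

End SetWords.

Lemma set_words_setT n :
  perm_eq (set_words [set: 'I_n]) [seq letters a | a : 'S_n].
Proof.
apply: uniq_perm => [||w]; first exact: permutations_uniq.
  by rewrite map_inj_uniq -?enumT ?enum_uniq //; apply: letters_inj.
apply/set_wordsP/mapP => [[w_uniq wT]|[a _ ->]]; last first.
  by split=> [|x]; rewrite ?letters_uniq // mem_letters inE.
have size_w : size w = n.
  by rewrite -(card_uniqP w_uniq) (eq_card wT) cardsT card_ord.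
pose tw := Tuple (introT eqP size_w).
have tw_inj : injective (tnth tw) by apply/tuple_uniqP.
exists (perm tw_inj); rewrite ?mem_enum //.
rewrite -[LHS]/(tval tw) -[in LHS](map_tnth_enum tw).
by apply: eq_map => i; rewrite permE.
Qed.

Lemma bid_mulZ (k : fieldType) (c : k) (u v : lorder) :
  bid k u * (c *: bid k v) = c *: bid k (lo_mul u v).
Proof.
have scaleU w : c *: bid k w = (<< c *g w >> : {malg k[lorder]}).
  by apply/malgP => w'; rewrite mcoeffZ !mcoeffU mulrnAr mulr1.
by rewrite !scaleU [LHS]fgmulUU mul1r.
Qed.

Section Takeuchi.
Variables (k : fieldType) (n : nat) (alpha : 'S_n).
Implicit Types (P Q : {set 'I_n}) (b d : seq 'I_n) (F : {set 'I_n} -> PR k).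

(* When F Q = f (alpha|_Q), this is (id * f) (alpha|_Q). *)
Definition conv_id_st F Q : PR k :=
  \sum_(P : {set 'I_n} | P \subset Q) bid k (lo (st alpha P)) * F (Q :\: P).

Lemma conv_id_st_inj F F' : conv_id_st F =1 conv_id_st F' -> F =1 F'.
Proof.
move=> eqFF' Q; have [N] := ubnP #|Q|.
elim: N Q => // N IHN Q; rewrite ltnS => QN.
have eq_tail :
    \sum_(P : {set 'I_n} | (P \subset Q) && (P != set0))
       bid k (lo (st alpha P)) * F (Q :\: P) =
    \sum_(P : {set 'I_n} | (P \subset Q) && (P != set0))
       bid k (lo (st alpha P)) * F' (Q :\: P).
  apply: eq_bigr => P /andP[PQ P0]; rewrite IHN //.
  rewrite -card_gt0 in P0; have := subset_leq_card PQ.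
  by rewrite cardsD (setIidPr PQ); lia.
have := eqFF' Q; rewrite /conv_id_st (bigD1 set0) ?sub0set //= eq_tail.
rewrite [RHS](bigD1 set0) ?sub0set //= => /addIr.
by rewrite lo_st0 ?cards0 // bid_one !mul1r !setD0.
Qed.

Lemma conv_id_st_antipode (S : {linear PR k -> PR k}) : is_antipode S ->
  conv_id_st (fun Q => S (bid k (lo (st alpha Q)))) =1 fun Q => (Q == set0)%:R.
Proof.
move=> hS Q; have [_] := hS (bid k (lo (st alpha Q))).
rewrite convolutionE lin_extU -lin_ext_bunit lin_extU bconv_st.
by rewrite /bunit /= cards_eq0.
Qed.

Definition word_sign := cut_sign (letter_rank (eps n)) (letter_rank alpha) k.

Definition signed_words Q : PR k :=
  \sum_(b <- set_words Q) \sum_(d <- set_words Q)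
    word_sign b d *: bid k (index_word b d).

Lemma subword_set_words (s : 'S_n) P : subword s P \in set_words P.
Proof.
by apply/set_wordsP; split=> [|x]; rewrite ?subword_uniq ?mem_subword.
Qed.

Definition starts_with b d P :=
  (take #|P| b == subword (eps n) P) && (take #|P| d == subword alpha P).

Lemma bid_mul_signed_words P Q : P \subset Q ->
  bid k (lo (st alpha P)) * signed_words (Q :\: P) =
  \sum_(b <- set_words Q) \sum_(d <- set_words Q | starts_with b d P)
     word_sign (drop #|P| b) (drop #|P| d) *: bid k (index_word b d).
Proof.
move=> PQ; transitivity (
  \sum_(b <- set_words Q | take #|P| b == subword (eps n) P)
    \sum_(d <- set_words Q | take #|P| d == subword alpha P)
      word_sign (drop #|P| b) (drop #|P| d) *: bid k (index_word b d)); last first.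
  rewrite big_mkcond; apply: eq_bigr => b _; rewrite /starts_with.
  by case: (take #|P| b == _) => //=; rewrite big_pred0.
have size_subword s : size (subword s P) = #|P|.
  exact: size_set_words (subword_set_words s P).
rewrite (big_set_words_prefix _ (subword_set_words _ _)) // mulr_sumr.
rewrite !big_seq; apply: eq_bigr => b b_in.
rewrite (big_set_words_prefix _ (subword_set_words _ _)) // mulr_sumr.
rewrite !big_seq; apply: eq_bigr => d d_in.
rewrite !drop_size_cat // bid_mulZ lo_mul_index_word //.
  move: b_in; rewrite -(cat_set_words _ PQ (subword_set_words (eps n) P)).
  by rewrite subword_eps => /set_wordsP[].
exact: perm_set_words d_in.
Qed.

Lemma sum_word_sign_drop Q b d : b \in set_words Q -> d \in set_words Q ->
  \sum_(P : {set 'I_n} | (P \subset Q) && starts_with b d P)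
    word_sign (drop #|P| b) (drop #|P| d) = (Q == set0)%:R.
Proof.
move=> bQ dQ; have [b_uniq mem_b] := set_wordsP _ _ bQ.
have size_b := size_set_words bQ.
rewrite -cards_eq0 -size_b size_eq0.
rewrite -(sum_cut_sign_drop (letter_rank (eps n)) (letter_rank alpha) k
            (perm_set_words bQ dQ)).
pose prefix_set (p : 'I_(size b).+1) := [set x in take p b].
have card_prefix_set p : #|prefix_set p| = p.
  by rewrite cardsE (card_uniqP (take_uniq _ b_uniq)) size_takel // -ltnS.
rewrite (reindex_onto prefix_set (fun P => inord #|P|)) /=; last first.
  move=> P /andP[PQ /andP[/eqP take_b _]]; apply/setP=> x.
  by rewrite inE inordK ?take_b ?mem_subword // ltnS size_b subset_leq_card.
apply: eq_big => p; rewrite /starts_with card_prefix_set //.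
rewrite inord_val eqxx andbT.
have -> : prefix_set p \subset Q.
  by apply/subsetP=> x; rewrite inE => /mem_take; rewrite mem_b.
rewrite andTb.
apply/andP/and3P => [[/eqP take_b /eqP take_d]|[bd_p b_sorted d_sorted]].
  by rewrite /perm_take take_b take_d !sorted_subword perm_subword.
split; apply/eqP/eq_subword => // x; rewrite inE //.
by rewrite (perm_mem bd_p).
Qed.

Lemma conv_id_st_signed_words :
  conv_id_st signed_words =1 fun Q => (Q == set0)%:R.
Proof.
move=> Q; rewrite /conv_id_st (eq_bigr _ (fun P => @bid_mul_signed_words P Q)).
transitivity (\sum_(b <- set_words Q) \sum_(d <- set_words Q)
                (Q == set0)%:R *: bid k (index_word b d)).
  rewrite exchange_big !big_seq; apply: eq_bigr => b bQ.
  rewrite (exchange_big_dep predT) //= !big_seq; apply: eq_bigr => d dQ.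
  by rewrite -scaler_suml sum_word_sign_drop.
have [->|_] := eqVneq Q set0; last first.
  by rewrite big1 // => b _; rewrite big1 // => d _; rewrite scale0r.
rewrite set_words0 !big_seq1 scale1r -bid_one; congr bid.
by apply: lo_seq_inj; rewrite index_wordK // lo_seq_one.
Qed.

Lemma antipode_signed_words (S : {linear PR k -> PR k}) : is_antipode S ->
  S (bas k alpha) =
  \sum_(b : 'S_n) \sum_(d : 'S_n)
    word_sign (letters b) (letters d)
      *: bid k (index_word (letters b) (letters d)).
Proof.
move=> hS.
have -> : bas k alpha = bid k (lo (st alpha setT)) by rewrite lo_st_setT.
have SE : (fun Q => S (bid k (lo (st alpha Q)))) =1 signed_words.
  apply: conv_id_st_inj => Q.
  by rewrite conv_id_st_antipode // conv_id_st_signed_words.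
rewrite (SE setT) /signed_words (perm_big _ (set_words_setT n)) big_image /=.
by apply: eq_bigr => b _; rewrite (perm_big _ (set_words_setT n)) big_image.
Qed.

End Takeuchi.

(** * The starts of the parts of a set composition *)

Section Coarsenings.
Local Open Scope nat_scope.
Variable T : finType.
Implicit Types (b d l : seq T) (bb : seq (seq T)) (L : seq {set T}).

Lemma card_set_of_seq l : uniq l -> #|[set x in l]| = size l.
Proof. by move=> /card_uniqP <-; rewrite cardsE. Qed.

Lemma bigcup_coarsening b L :
  coarsening b L -> \bigcup_(P <- L) P = [set x in b].
Proof.
case=> bb <- ->; apply/setP=> x; rewrite big_map inE.
elim: bb => [|l bb IHbb]; first by rewrite big_nil inE.
by rewrite big_cons !inE IHbb mem_cat.
Qed.

Lemma sum_card_coarsening b L :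
  uniq b -> coarsening b L -> \sum_(P <- L) #|P| = size b.
Proof.
move=> + [bb b_cat ->] {L}; rewrite -{}b_cat big_map.
elim: bb => [|l bb IHbb]; first by rewrite big_nil.
rewrite /= cat_uniq big_cons size_cat => /and3P[l_uniq _ bb_uniq].
by rewrite card_set_of_seq // IHbb.
Qed.

Lemma card_bigcup_coarsening b L : uniq b -> coarsening b L ->
  #|\bigcup_(P <- L) P| = \sum_(P <- L) #|P|.
Proof.
move=> b_uniq bL; rewrite (bigcup_coarsening bL) card_set_of_seq //.
by rewrite (sum_card_coarsening b_uniq).
Qed.

Definition part_start L i := \sum_(P <- take i L) #|P|.

Definition part_starts L := [seq part_start L i | i <- iota 0 (size L)].

Lemma part_start0 L : part_start L 0 = 0.
Proof. by rewrite /part_start take0 big_nil. Qed.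

Lemma part_startS L i : i < size L ->
  part_start L i.+1 = part_start L i + #|nth set0 L i|.
Proof. by move=> iL; rewrite /part_start (take_nth set0) // big_rcons. Qed.

Lemma part_start_size b L :
  uniq b -> coarsening b L -> part_start L (size L) = size b.
Proof. by rewrite /part_start take_size; apply: sum_card_coarsening. Qed.

Lemma part_startsP L p :
  reflect (exists2 i, i < size L & p = part_start L i) (p \in part_starts L).
Proof.
apply: (iffP mapP) => -[i]; first by rewrite mem_iota => iL ->; exists i.
by move=> iL ->; exists i; rewrite // mem_iota.
Qed.

Lemma part_start_flatten bb i : uniq (flatten bb) ->
  part_start [seq [set x in l] | l <- bb] i = size (flatten (take i bb)).
Proof.
rewrite -{1}(cat_take_drop i bb) flatten_cat cat_uniq => /and3P[bbi_uniq _ _].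
by apply: sum_card_coarsening => //; exists (take i bb); rewrite ?map_take.
Qed.

Lemma coarsening_take b L i : uniq b -> coarsening b L ->
  coarsening (take (part_start L i) b) (take i L).
Proof.
move=> + [bb b_cat ->]; rewrite -{}b_cat => bb_uniq.
exists (take i bb); last by rewrite map_take.
rewrite part_start_flatten // -{3}(cat_take_drop i bb) flatten_cat.
by rewrite take_size_cat.
Qed.

Lemma perm_take_coarsening b d L i : uniq b -> uniq d ->
  coarsening b L -> coarsening d L -> perm_take b d (part_start L i).
Proof.
move=> b_uniq d_uniq bL dL; apply: uniq_perm; rewrite ?take_uniq // => x.
have bLi := bigcup_coarsening (coarsening_take i b_uniq bL).
have dLi := bigcup_coarsening (coarsening_take i d_uniq dL).
by have /setP/(_ x) := etrans (esym bLi) dLi; rewrite !inE.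
Qed.

Lemma mem_coarsening_part b L i x : uniq b -> coarsening b L -> i < size L ->
  (x \in nth set0 L i) = (part_start L i <= index x b < part_start L i.+1).
Proof.
move=> + [bb b_cat ->]; rewrite -{}b_cat size_map => bb_uniq ibb.
rewrite !part_start_flatten // (take_nth [::]) // flatten_rcons size_cat.
rewrite (nth_map [::]) // inE.
set l := nth [::] bb i; set bbi := flatten (take i bb).
have bb_cat : flatten bb = bbi ++ l ++ flatten (drop i.+1 bb).
  by rewrite -{1}(cat_take_drop i bb) (drop_nth [::]) // flatten_cat.
move: bb_uniq; rewrite bb_cat cat_uniq has_cat negb_or.
case/and3P=> _ /andP[/hasPn lNbbi _] _; rewrite !index_cat.
have [xl|xNl] := boolP (x \in l).
  by rewrite (negbTE (lNbbi x xl)) leq_addr ltn_add2l index_mem xl.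
have [xbbi|xNbbi] := boolP (x \in bbi); last first.
  by rewrite ltn_add2l (ltnNge _ (size l)) !leq_addr.
by rewrite leqNgt index_mem xbbi.
Qed.

Lemma coarsening_cut b d p : perm_eq b d -> perm_take b d p ->
  coarsening d [:: [set x in take p b]; [set x in drop p b]].
Proof.
move=> bd bd_p; exists [:: take p d; drop p d].
  by rewrite /= cats0 cat_take_drop.
have bd_drop : perm_eq (drop p b) (drop p d).
  by rewrite -(perm_cat_cancel _ _ bd_p) !cat_take_drop.
congr [:: _; _]; apply/setP=> x; rewrite !inE; first exact: perm_mem bd_p x.
exact: perm_mem bd_drop x.
Qed.

Section Nonempty.
Variable L : seq {set T}.
Hypothesis L_neq0 : set0 \notin L.

Lemma part_start_mono :
  {in [pred i | i <= size L] &, {mono part_start L : i j / i <= j}}.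
Proof.
apply: leq_mono_in; apply: homo_ltn_in => [|i j _ jL m /andP[_ mj]|i _ iL].
- exact: ltn_trans.
- exact: ltnW (leq_trans mj jL).
- rewrite part_startS // -addn1 leq_add2l card_gt0.
  by apply: contraNneq L_neq0 => <-; apply: mem_nth.
Qed.

Lemma part_start_ltS i : i < size L -> part_start L i < part_start L i.+1.
Proof.
by move=> iL; rewrite (leqW_mono_in part_start_mono) ?inE // ltnW.
Qed.

Lemma part_starts_inside i p :
  i < size L -> part_start L i < p < part_start L i.+1 ->
  p \notin part_starts L.
Proof.
move=> iL /andP[ip pi]; apply/part_startsP => -[j jL pj]; move: ip pi.
by rewrite pj !(leqW_mono_in part_start_mono) ?inE //; lia.
Qed.

Variable b : seq T.
Hypotheses (b_uniq : uniq b) (bL : coarsening b L).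

Lemma part_start_lt i : i < size L -> part_start L i < size b.
Proof.
move=> iL; rewrite -(part_start_size b_uniq bL).
by rewrite (leqW_mono_in part_start_mono) ?inE // ltnW.
Qed.

Lemma count_part_starts :
  count (mem (part_starts L)) (iota 0 (size b)) = size L.
Proof.
rewrite -size_filter -[RHS](size_iota 0) -(size_map (part_start L)).
apply/perm_size/uniq_perm; rewrite ?filter_uniq ?iota_uniq //.
  rewrite map_inj_in_uniq ?iota_uniq // => i j; rewrite !mem_iota /= => iL jL.
  by apply: (incn_inj_in part_start_mono); rewrite inE ltnW.
move=> p; rewrite mem_filter mem_iota; apply/andP/idP => [[]//|p_start].
by split=> //; case/part_startsP: p_start => i iL ->; apply: part_start_lt.
Qed.

Lemma exists_part p : p < size b ->
  exists2 i, i < size L & part_start L i <= p < part_start L i.+1.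
Proof.
move=> pb; have [_ _ _ cover] := coarsening_disjoint b_uniq L_neq0 bL.
have x0 : T by case: (b) pb.
have [_ /(nthP set0)[i iL <-]] := cover _ (mem_nth x0 pb).
by rewrite (mem_coarsening_part _ b_uniq bL iL) index_uniq //; exists i.
Qed.

End Nonempty.
End Coarsenings.

Section Extrema.
Local Open Scope nat_scope.
Variable n : nat.
Implicit Types (w s : 'S_n) (P Q : {set 'I_n}).

Lemma increasing_withinP w s P : reflect
  (forall x y : 'I_n, x < y -> w x \in P -> w y \in P ->
     letter_rank s (w x) < letter_rank s (w y))
  (increasing_within w s P).
Proof.
apply: (iffP forallP) => [incr x y xy wx wy|incr x].
  by have /forallP/(_ y) := incr x; rewrite xy wx wy.
by apply/forallP => y; apply/implyP => /and3P[xy wx wy]; apply: incr.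
Qed.

Lemma max_gt_minE s P Q x y : is_max s P x -> is_min s Q y ->
  max_gt_min s P Q = lt_wrt s y x.
Proof.
move=> x_max y_min; apply/existsP/idP => [[x']|yx]; last first.
  by exists x; apply/existsP; exists y; rewrite x_max y_min.
case/existsP=> y' /and3P[/andP[x'P _] /andP[y'Q _] y'x'].
have /andP[_ /forall_inP/(_ x' x'P)] := x_max; rewrite -leqNgt => x'x.
have /andP[_ /forall_inP/(_ y' y'Q)] := y_min; rewrite -leqNgt => yy'.
exact: leq_ltn_trans yy' (leq_trans y'x' x'x).
Qed.

End Extrema.

Section IncreasingParts.
Local Open Scope nat_scope.
Variables (n : nat) (w s : 'S_n) (L : seq {set 'I_n}).
Hypotheses (L_neq0 : set0 \notin L) (wL : coarsening (letters w) L).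

Let w_uniq : uniq (letters w) := letters_uniq w.
Local Notation w_descent := (descent (letter_rank s) (letters w)).

Lemma mem_part i (x : 'I_n) : i < size L ->
  (w x \in nth set0 L i) = (part_start L i <= x < part_start L i.+1).
Proof.
by move=> iL; rewrite (mem_coarsening_part _ w_uniq wL iL) index_letters.
Qed.

Lemma part_start_le i : i <= size L -> part_start L i <= n.
Proof.
move=> iL; rewrite -[leqRHS](size_letters w) -(part_start_size w_uniq wL).
by rewrite (part_start_mono L_neq0) ?inE.
Qed.

Lemma all_increasing_withinP :
  reflect (forall p, p < n -> w_descent p -> p \in part_starts L)
    (all (increasing_within w s) L).
Proof.
apply: (iffP (all_nthP set0)) => [incr p pn|desc_start i iL].
  apply: contraTT => pNstart; rewrite -ltnNge.
  have [i iL /andP[ip pi]] : exists2 i, i < size L &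
      part_start L i <= p < part_start L i.+1.
    by apply: (exists_part L_neq0 w_uniq wL); rewrite size_letters.
  move: ip; rewrite leq_eqVlt => /predU1P[ip|ip].
    by case/part_startsP: pNstart; exists i.
  have p1n : p.-1 < n by lia.
  rewrite (rank_at_letters s w (Ordinal p1n)).
  rewrite (rank_at_letters s w (Ordinal pn)).
  have /increasing_withinP w_lt := incr i iL.
  by apply: w_lt; rewrite ?mem_part //=; lia.
apply/increasing_withinP => x y xy; rewrite !mem_part // => x_in y_in.
rewrite -!rank_at_letters.
pose D := [pred q | part_start L i <= q < part_start L i.+1].
apply: (homo_ltn_in (D := D) (r := fun q r => q < r) _ _ _ x_in y_in xy).
- exact: ltn_trans.
- by move=> q r qD rD m; rewrite !inE in qD rD *; lia.
- move=> q qD q1D; rewrite !inE in qD q1D.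
  rewrite ltnNge; apply/negP => q1_desc.
  have q1n : q.+1 < n by have := part_start_le iL; lia.
  suff /negP[] : q.+1 \notin part_starts L by apply: desc_start.
  by apply: (part_starts_inside L_neq0 iL); lia.
Qed.

Hypothesis w_incr : all (increasing_within w s) L.

Lemma letter_rank_part i (x y : 'I_n) : i < size L ->
  part_start L i <= x -> x <= y -> y < part_start L i.+1 ->
  letter_rank s (w x) <= letter_rank s (w y).
Proof.
move=> iL ix; rewrite leq_eqVlt => /predU1P[/val_inj-> //|xy yi].
have /increasing_withinP w_lt := all_nthP set0 w_incr i iL.
by apply/ltnW/w_lt; rewrite ?mem_part //; lia.
Qed.

Lemma is_max_part_last i (x : 'I_n) :
  i < size L -> x.+1 = part_start L i.+1 ->
  is_max s (nth set0 L i) (w x).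
Proof.
move=> iL xE; have i_lt := part_start_ltS L_neq0 iL.
rewrite /is_max mem_part //.
apply/andP; split; first by lia.
apply/forall_inP => z; rewrite -(permKV w z) mem_part // => z_in.
rewrite /lt_wrt -leqNgt.
by apply: (letter_rank_part iL); lia.
Qed.

Lemma is_min_part_start i (x : 'I_n) :
  i < size L -> x = part_start L i :> nat ->
  is_min s (nth set0 L i) (w x).
Proof.
move=> iL xE; have i_lt := part_start_ltS L_neq0 iL.
rewrite /is_min mem_part //.
apply/andP; split; first by lia.
apply/forall_inP => z; rewrite -(permKV w z) mem_part // => z_in.
rewrite /lt_wrt -leqNgt.
by apply: (letter_rank_part iL); lia.
Qed.

Lemma max_gt_min_descent i : i.+1 < size L ->
  max_gt_min s (nth set0 L i) (nth set0 L i.+1) = w_descent (part_start L i.+1).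
Proof.
move=> iL; have iL' := ltnW iL; have pn := part_start_lt L_neq0 w_uniq wL iL.
rewrite size_letters in pn.
have p_gt0 : 0 < part_start L i.+1.
  exact: leq_ltn_trans (part_start_ltS L_neq0 iL').
have p1n : (part_start L i.+1).-1 < n by lia.
rewrite (max_gt_minE (is_max_part_last (x := Ordinal p1n) iL' _)
                     (is_min_part_start (x := Ordinal pn) iL _)) //= ?prednK //.
rewrite /descent (rank_at_letters s w (Ordinal pn)).
rewrite (rank_at_letters s w (Ordinal p1n)).
rewrite leq_eqVlt (inj_eq (@letter_rank_inj n s)) (inj_eq perm_inj) -val_eqE /=.
by rewrite gtn_eqF // ltn_predL.
Qed.

End IncreasingParts.

(** * The join of two words *)

Section Join.
Local Open Scope nat_scope.
Variable n : nat.
Implicit Types (a b c d : 'S_n) (B : seq {set 'I_n}).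

Lemma coarsening_setcomp b B : set0 \notin B -> coarsening (letters b) B ->
  exists D : setcomp n, parts D = B :> seq _.
Proof.
move=> B_neq0 bB.
have [B_uniq size_B B_disj B_cover] :=
  coarsening_disjoint (letters_uniq b) B_neq0 bB.
rewrite size_letters in size_B.
suff BP : is_setcomp (Bseq size_B) by exists (SetComp BP).
rewrite /is_setcomp B_uniq /=; apply/and3P; split; rewrite ?in_set //.
rewrite eqEsubset subsetT; apply/subsetP=> x _.
have [P PB xP] := B_cover x (mem_letters b x).
by apply/bigcupP; exists P; rewrite ?in_set.
Qed.

Lemma coarsening_wjoinl b d : coarsening (letters b) (wjoin b d).
Proof. by have /and3P[/refines_wordP] := wjoinP b d. Qed.

Lemma coarsening_wjoinr b d : coarsening (letters d) (wjoin b d).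
Proof. by have /and3P[_ /refines_wordP] := wjoinP b d. Qed.

Lemma wjoin_least b d B : set0 \notin B ->
  coarsening (letters b) B -> coarsening (letters d) B ->
  exists2 Ls, flatten Ls = wjoin b d & B = [seq \bigcup_(P <- L) P | L <- Ls].
Proof.
move=> B_neq0 bB dB; have [D DB] := coarsening_setcomp B_neq0 bB.
have /and3P[_ _ /forallP/(_ D)] := wjoinP b d; rewrite -DB.
rewrite (introT (refines_wordP _ _)) ?DB // (introT (refines_wordP _ _)) ?DB //.
by case/refinesP=> Ls Ls_flat; rewrite DB => BE; exists Ls.
Qed.

(* A common prefix set cuts [n] into a composition with two parts, which the
   join has to refine. *)
Lemma perm_take_part_start b d p : 0 < p < n ->
  perm_take (letters b) (letters d) p -> p \in part_starts (wjoin b d).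
Proof.
case/andP=> p_gt0 pn bd_p; have bL := coarsening_wjoinl b d.
set L : seq _ := wjoin b d in bL *.
have take_uniq_b := take_uniq p (letters_uniq b).
have [|||Ls Ls_flat] := @wjoin_least b d
    [:: [set x in take p (letters b)]; [set x in drop p (letters b)]].
- rewrite !inE !(eq_sym set0) -!cards_eq0.
  rewrite !card_set_of_seq ?drop_uniq ?letters_uniq //.
  by rewrite size_drop size_takel size_letters; lia.
- by apply: coarsening_cut; rewrite // /perm_take.
- by apply: coarsening_cut; rewrite ?perm_letters.
case: Ls Ls_flat => // L1 Ls L_cat [L1E _].
have pE : p = part_start L (size L1).
  have L1_take : take (size L1) L = L1 by rewrite /L -L_cat /= take_size_cat.
  have bL1 := coarsening_take (size L1) (letters_uniq b) bL.
  have bL1_uniq := take_uniq (part_start L (size L1)) (letters_uniq b).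
  rewrite [RHS](esym (card_bigcup_coarsening bL1_uniq bL1)).
  by rewrite L1_take -L1E card_set_of_seq // size_takel // size_letters ltnW.
apply/part_startsP; exists (size L1) => //; rewrite ltn_neqAle.
have -> : size L1 <= size L by rewrite /L -L_cat size_cat leq_addr.
rewrite andbT; apply: contraTneq pn => L1_all.
by rewrite pE L1_all (part_start_size (letters_uniq b) bL) size_letters ltnn.
Qed.

Lemma perm_take_wjoin b d p : p < n ->
  perm_take (letters b) (letters d) p = (p \in part_starts (wjoin b d)).
Proof.
move=> pn; have [bL dL] := (coarsening_wjoinl b d, coarsening_wjoinr b d).
have [b_uniq d_uniq] := (letters_uniq b, letters_uniq d).
have [->|p_gt0] := posnP p; last first.
  apply/idP/part_startsP => [bd_p|[i _ ->]]; last exact: perm_take_coarsening.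
  by apply/part_startsP/perm_take_part_start; rewrite ?p_gt0.
rewrite perm_take0; apply/esym/part_startsP.
exists 0; rewrite ?part_start0 // lt0n.
apply: contraTneq pn => L_nil.
rewrite -[n in _ < n](size_letters b) -(part_start_size b_uniq bL).
by rewrite L_nil part_start0.
Qed.

Lemma size_wjoin b d :
  size (wjoin b d) = count (perm_take (letters b) (letters d)) (iota 0 n).
Proof.
have := count_part_starts (setcomp0 (wjoin b d)) (letters_uniq b)
          (coarsening_wjoinl b d).
rewrite size_letters => <-; apply: eq_in_count => p; rewrite mem_iota => pn.
by rewrite perm_take_wjoin.
Qed.

(* Conditions (i) and (ii) say that every descent starts a part of the join and,
   given these, (iii) says that every part of the join starts with a descent. *)
Lemma d_condE a c b : d_cond a c b =
  all (fun p => perm_take (letters b) (letters (wcomp b c)) p ==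
     pair_descent (letter_rank (eps n)) (letter_rank a)
       (letters b) (letters (wcomp b c)) p) (iota 0 n).
Proof.
rewrite /d_cond; set d := wcomp b c; set L := wjoin b d.
have [bL dL] := (coarsening_wjoinl b d, coarsening_wjoinr b d).
have L_neq0 := setcomp0 L.
have b_incrP := all_increasing_withinP (eps n) L_neq0 bL.
have d_incrP := all_increasing_withinP a L_neq0 dL.
apply/and3P/allP => [[b_incr d_incr /forallP max_gt] p|start_eq_desc].
  rewrite mem_iota => pn; rewrite perm_take_wjoin //.
  apply/eqP; apply/idP/orP => [/part_startsP[[|i] iL ->]|[b_desc|d_desc]].
  - by left; rewrite part_start0 descent0.
  - have i_n : i < n := ltnW (leq_trans iL (size_bseq _)).
    have /implyP/(_ iL) := max_gt (Ordinal i_n).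
    rewrite (max_gt_min_descent L_neq0 bL) // (max_gt_min_descent L_neq0 dL) //.
    by move/orP.
  - exact: b_incrP.
  - exact: d_incrP.
have startE p : p < n -> (p \in part_starts L) =
    pair_descent (letter_rank (eps n)) (letter_rank a) (letters b) (letters d) p.
  move=> pn; rewrite -perm_take_wjoin //.
  by apply/eqP/start_eq_desc; rewrite mem_iota.
have b_incr : all (increasing_within b (eps n)) L.
  by apply/b_incrP => p pn b_desc; rewrite startE // /pair_descent b_desc.
have d_incr : all (increasing_within d a) L.
  by apply/d_incrP => p pn d_desc; rewrite startE // /pair_descent d_desc orbT.
split=> //; apply/forallP => i; apply/implyP => iL.
rewrite (max_gt_min_descent L_neq0 bL) // (max_gt_min_descent L_neq0 dL) //.
have := part_start_lt L_neq0 (letters_uniq b) bL iL; rewrite size_letters => pn.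
by rewrite -[X in is_true X]startE //; apply/part_startsP; exists i.+1.
Qed.

Lemma word_sign_wcomp (k : fieldType) a b c :
  word_sign k a (letters b) (letters (wcomp b c)) =
  (if d_cond a c b then (-1) ^+ size (wjoin (eps n) c) else 0)%R.
Proof.
rewrite /word_sign /cut_sign size_letters prod_cut_factor.
rewrite /index_iota subn0 -d_condE.
by rewrite size_wjoin (eq_count (perm_take_wcomp b c)).
Qed.

End Join.

Theorem theorem4p9 (k : fieldType) (char_k : [pchar k] =i pred0)
  (S : {linear PR k -> PR k}) (hS : is_antipode S)
  (n : nat) (alpha : 'S_n) :
  S (bas k alpha) =
  \sum_(gamma : 'S_n)
     ((-1) ^+ size (wjoin (eps n) gamma) * (d_coef alpha gamma)%:R)
       *: bas k gamma.
Proof.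
rewrite antipode_signed_words //.
transitivity (\sum_(b : 'S_n) \sum_(gamma : 'S_n)
  (if d_cond alpha gamma b then (-1) ^+ size (wjoin (eps n) gamma) else 0)
    *: bas k gamma).
  apply: eq_bigr => b _; have wcomp_inj : injective (wcomp b) by exact: mulIg.
  rewrite [LHS](reindex_inj wcomp_inj); apply: eq_bigr => gamma _.
  by rewrite word_sign_wcomp index_word_wcomp.
rewrite exchange_big; apply: eq_bigr => gamma _.
rewrite -scaler_suml -big_mkcond sumr_const mulr_natr.
by congr (_ *+ _ *: _); apply: eq_card => b; rewrite inE.
Qed.
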